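(* Let $\Phi$ be a generalized Orlicz function and $H_\Phi$ the corresponding Orlicz premium on $L^\Phi_+$. Then: (a) $H_\Phi$ is monotone, positively homogeneous and satisfies $H_\Phi(c)=c$ for all $c\in[0,+\infty)$. (b) If $H_\Phi(X)>0$, then $H_\Phi(X)=\min\{k>0:\mathbb E[\Phi(X/k)]\le1\}$. (c) It holds that $H_\Phi(X)\le1\iff\mathbb E[\Phi(X)]\le1$. (d) If $\Phi$ is strictly increasing and continuous and $X\in L^\infty(\Omega,\mathcal F,P)$, then $H_\Phi=H_\Phi(X)$ is the unique solution of the equation $\mathbb E[\Phi(X/H_\Phi)]=1$. (e) If $\Phi$ is convex, then $H_\Phi$ is convex. (f) If there exists $u<1$ with $\Phi(u)<1$, then $H_\Phi$ is convex only if $\Phi$ is convex. (g) $H_\Phi$ is law-invariant, in the sense that if $X$ and $Y$ have the same distribution, then $H_\Phi(X)=H_\Phi(Y)$.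
   Context: Random variables are defined on a nonatomic probability space $(\Omega,\mathcal F,P)$; equalities and inequalities between them hold $P$-a.s. A generalized Orlicz function is a function $\Phi\colon[0,+\infty)\to[0,+\infty)$ that is nondecreasing, left-continuous, and satisfies $\Phi(x)\le1$ for $x\le1$ and $\Phi(x)>1$ for $x>1$. Set $L^\Phi=\{X\in L^0(\Omega,\mathcal F,P): \mathbb E[\Phi(|X|/k)]\le1\text{ for some }k>0\}$ and $L^\Phi_+=\{X\in L^\Phi: X\ge0\}$. For $X\in L^\Phi_+$ the Orlicz premium is $H_\Phi(X)=\inf\{k>0:\mathbb E[\Phi(X/k)]\le1\}$ (with $\inf\emptyset=+\infty$ outside $L^\Phi_+$). All random variables $X,Y$ in the claim are nonnegative and belong to $L^\Phi_+$. Monotone means $X\le Y\Rightarrow H_\Phi(X)\le H_\Phi(Y)$; positively homogeneous means $H_\Phi(\lambda X)=\lambda H_\Phi(X)$ for all $\lambda\ge0$; convex means $H_\Phi(\lambda X+(1-\lambda)Y)\le\lambda H_\Phi(X)+(1-\lambda)H_\Phi(Y)$ for all $X,Y\in L^\Phi_+$, $\lambda\in[0,1]$.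
   Formalization: Part (d) is stated under the extra hypothesis H_Φ(X) > 0; without it the claim fails, e.g. for X = 0, where H_Φ(X) = 0 and E[Φ(X/h)] = Φ(0) < 1 for every h > 0. *)

(* Defs.v *)
From mathcomp Require Export all_boot all_order all_algebra.
From mathcomp Require Export all_classical all_reals all_analysis.

Set Implicit Arguments.
Unset Strict Implicit.
Unset Printing Implicit Defensive.
Import Order.TTheory GRing.Theory Num.Theory.
Import numFieldNormedType.Exports.

Local Open Scope classical_set_scope.
Local Open Scope ring_scope.

(* A function [0,+oo) -> [0,+oo) is encoded by Phi : R -> R together with
   conditions on nonnegative arguments only; the values of Phi at negative
   arguments are unconstrained and play no role below, where Phi is composed
   with random variables that are nonnegative almost surely.
   Left-continuity is void at 0. *)
Record generalized_orlicz (R : realType) (Phi : R -> R) : Prop := {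
  orlicz_ge0 : forall x, 0 <= x -> 0 <= Phi x ;
  orlicz_nondecreasing : forall x y, 0 <= x -> x <= y -> Phi x <= Phi y ;
  orlicz_left_continuous :
    forall x, 0 < x -> Phi y @[y --> x^'-] --> Phi x ;
  orlicz_le1 : forall x, 0 <= x -> x <= 1 -> Phi x <= 1 ;
  orlicz_gt1 : forall x, 1 < x -> 1 < Phi x
}.

Section Orlicz.
Context {d : measure_display} {T : measurableType d} {R : realType}.
Variable P : probability T R.
Variable Phi : R -> R.

Definition nonatomic : Prop :=
  forall A : set T, measurable A -> (0 < P A)%E ->
    exists B : set T, [/\ measurable B, B `<=` A, (0 < P B)%E & (P B < P A)%E].

Definition orlicz_space : set {RV P >-> R} :=
  [set X | exists2 k : R, 0 < k & ('E_P[fun w => Phi (`|X w| / k)%R] <= 1)%E].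

Definition orlicz_space_pos : set {RV P >-> R} :=
  [set X | orlicz_space X /\ {ae P, forall w, 0 <= X w}].

Definition orlicz_levels (X : T -> R) : set R :=
  [set k | 0 < k /\ ('E_P[fun w => Phi (X w / k)%R] <= 1)%E].

(* ereal_inf set0 = +oo *)
Definition orlicz_premium (X : T -> R) : \bar R :=
  ereal_inf (EFin @` orlicz_levels X).

Definition premium_convex : Prop :=
  forall (X Y : {RV P >-> R}) (lam : R),
    orlicz_space_pos X -> orlicz_space_pos Y -> 0 <= lam -> lam <= 1 ->
    (orlicz_premium (fun w => (lam * X w + (1 - lam) * Y w)%R)
       <= lam%:E * orlicz_premium X + (1 - lam)%:E * orlicz_premium Y)%E.

End Orlicz.

Arguments orlicz_space {d T R} P Phi.
Arguments orlicz_space_pos {d T R} P Phi.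

Definition convex_on_nonneg (R : realType) (Phi : R -> R) : Prop :=
  convex_function (`[0, +oo[%classic : set (convex_lmodType R^o)) Phi.

(* Main.v *)
Require Import Defs.
From mathcomp Require Import measurable_realfun ess_sup_inf.
From mathcomp Require Import lra ring.
Import Order.TTheory GRing.Theory Num.Theory.
Import numFieldNormedType.Exports.
Local Open Scope classical_set_scope.
Local Open Scope ring_scope.

Set Implicit Arguments.
Unset Strict Implicit.
Unset Printing Implicit Defensive.

(* The levels of X, i.e. the k > 0 with E[Phi(X / k)] <= 1, form an up-set, and
   monotone convergence along k decreasing to H(X), together with left-continuity
   of Phi, shows that H(X) is itself a level when positive; this is (b) and (c).
   For (d), dominated convergence along k increasing to H(X) rules out an
   expectation below 1.  For (e), (t X + (1 - t) Y) / (t a + (1 - t) b) is a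
   convex combination of X / a and Y / b.
   For (f), by (c) the set of X with E[Phi(X)] <= 1 is convex.  On two events of
   equal small probability q let X take the values x, y and Y the values y, x;
   elsewhere let X = Y take the values u and 2, with probabilities chosen such
   that E[Phi(X)] = E[Phi(Y)] = 1, which is possible because Phi(u) < 1 < Phi(2).
   Then E[Phi((X + Y) / 2)] <= 1 says that Phi is midpoint convex at x, y, and
   left-continuity turns midpoint convexity into convexity.  The events exist by
   Sierpinski's theorem on the range of nonatomic measures. *)

(** * Comparison of integrals up to null sets, without measurability *)

Section integral_ae.
Context {d : measure_display} {T : measurableType d} {R : realType}.
Import HBNNSimple.
Variable mu : {measure set T -> \bar R}.
Local Open Scope ereal_scope.

(** Both integrals are suprema over simple functions. A simple function below [f], set to 0 on a
    measurable null set [N] containing the points where [f <= g] fails, lies below [g] everywhere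
    and keeps its integral, so neither [f] nor [g] has to be measurable. *)
Lemma ge0_integral_ae_le (f g : T -> \bar R) :
  (forall x, 0 <= f x) -> (forall x, 0 <= g x) ->
  {ae mu, forall x, f x <= g x} -> \int[mu]_x f x <= \int[mu]_x g x.
Proof.
move=> f0 g0 [N [mN N0 fgN]]; rewrite !ge0_integralTE//.
apply: ge_ereal_sup => _ [h hf <-].
pose k := proj_nnsfun h (measurableC mN).
have -> : sintegral mu h = sintegral mu k; last first.
  apply: ereal_sup_ubound; exists k => // x /=.
  rewrite mindicE; case: (boolP (x \in ~` N)) => xN; last by rewrite mulr0 g0.
  rewrite mulr1 (le_trans (hf x))//; apply: contrapT => fgx.
  by move: xN; rewrite inE/=; apply; exact: fgN.
rewrite -!integralT_nnsfun; apply: ge0_ae_eq_integral => //.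
- exact/measurable_EFinP.
- exact/measurable_EFinP.
- by move=> x _; rewrite lee_fin.
- by move=> x _; rewrite lee_fin.
- exists N; split => // x /= /not_implyP[_ hkx]; apply: contrapT => Nx.
  by apply: hkx; rewrite /= mindicE mem_set//= mulr1.
Qed.

Lemma integral_ae_congr (f g : T -> \bar R) :
  {ae mu, forall x, f x = g x} -> \int[mu]_x f x = \int[mu]_x g x.
Proof.
move=> fg; rewrite [LHS]integralE [RHS]integralE; congr (_ - _).
- apply/eqP; rewrite eq_le; apply/andP; split;
    apply: ge0_integral_ae_le => //; apply: filterS fg => x fgx;
    by rewrite !funeposE fgx.
- apply/eqP; rewrite eq_le; apply/andP; split;
    apply: ge0_integral_ae_le => //; apply: filterS fg => x fgx;
    by rewrite !funenegE fgx.
Qed.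

End integral_ae.

(* Phi is unconstrained on negative arguments, so Phi \o X need not be
   measurable even when X >= 0 a.s.; orlicz_pos Phi is monotone on all of R. *)
Definition orlicz_pos (R : realType) (Phi : R -> R) (x : R) : R :=
  Phi (Num.max x 0).

(** * Expectations through the monotone extension of [Phi] *)

Section orlicz_mean.
Context {d : measure_display} {T : measurableType d} {R : realType}.
Variables (P : probability T R) (Phi : R -> R).
Hypothesis hPhi : generalized_orlicz Phi.
Implicit Types (X Y : T -> R) (h k : R).

Lemma orlicz_pos_nondecreasing x y :
  x <= y -> orlicz_pos Phi x <= orlicz_pos Phi y.
Proof.
move=> xy; apply: (orlicz_nondecreasing hPhi).
  by rewrite le_max lexx orbT.
by rewrite ge_max !le_max xy lexx orbT.
Qed.

Lemma orlicz_pos_ge0 x : 0 <= orlicz_pos Phi x.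
Proof. by apply: (orlicz_ge0 hPhi); rewrite le_max lexx orbT. Qed.

Lemma orlicz_pos_le0 x : x <= 0 -> orlicz_pos Phi x <= 1.
Proof. by move=> x0; rewrite /orlicz_pos max_r//; apply: (orlicz_le1 hPhi). Qed.

Lemma measurable_orlicz_pos X : measurable_fun setT X ->
  measurable_fun setT (fun w => (orlicz_pos Phi (X w))%:E).
Proof.
move=> mX; apply/measurable_EFinP; apply: (measurableT_comp _ mX).
by apply: nondecreasing_measurable => // x y; exact: orlicz_pos_nondecreasing.
Qed.

(** The integrands agree wherever [X] is nonnegative, hence almost everywhere. For measurable [X]
    the right-hand one is measurable, so the convergence theorems apply to it. *)
Lemma expectation_orlicz X k : {ae P, forall w, 0 <= X w} -> 0 < k ->
  ('E_P[fun w => Phi (X w / k)] = \int[P]_w (orlicz_pos Phi (X w / k))%:E)%E.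
Proof.
move=> X0 k0; rewrite unlock; apply: integral_ae_congr.
by apply: filterS X0 => w Xw; rewrite /orlicz_pos max_l// divr_ge0// ltW.
Qed.

End orlicz_mean.

(** * Levels of a random variable and attainment of the infimum *)

Section premium.
Context {d : measure_display} {T : measurableType d} {R : realType}.
Variables (P : probability T R) (Phi : R -> R).
Hypothesis hPhi : generalized_orlicz Phi.
Variable X : T -> R.
Hypotheses (mX : measurable_fun setT X) (X0 : {ae P, forall w, 0 <= X w}).
Local Notation H := (orlicz_premium P Phi X).
Implicit Types h k : R.

Lemma measurable_orlicz_div k :
  measurable_fun setT (fun w => (orlicz_pos Phi (X w / k))%:E).
Proof. by apply: measurable_orlicz_pos => //; exact: measurable_funM. Qed.

Lemma orlicz_levels_le k k' :
  k <= k' -> orlicz_levels P Phi X k -> orlicz_levels P Phi X k'.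
Proof.
move=> kk' [k0 Ek]; have k'0 := lt_le_trans k0 kk'; split => //.
apply: le_trans Ek; rewrite !expectation_orlicz//.
apply: ge0_integral_ae_le => [w|w|]; rewrite ?lee_fin ?orlicz_pos_ge0//.
apply: filterS X0 => w Xw; rewrite lee_fin orlicz_pos_nondecreasing//.
by rewrite ler_wpM2l// lef_pV2.
Qed.

Lemma orlicz_premium_ge0 : (0 <= H)%E.
Proof. by apply/ereal_infP => _ [k [k0 _] <-]; rewrite lee_fin ltW. Qed.

Lemma orlicz_premium_le k : orlicz_levels P Phi X k -> (H <= k%:E)%E.
Proof. by move=> Xk; apply: ereal_inf_lbound; exists k. Qed.

Lemma orlicz_levels_gt k : (H < k%:E)%E -> orlicz_levels P Phi X k.
Proof.
move=> /ereal_inf_lt[_ [l Xl <-]]; rewrite lte_fin => /ltW lk.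
exact: orlicz_levels_le Xl.
Qed.

Lemma orlicz_levels_premium h :
  0 < h -> H = h%:E -> orlicz_levels P Phi X h.
Proof.
move=> h0 Hh; split => //; rewrite expectation_orlicz//.
(* The factors increase to 1 and stay strictly below it, so every [h / c n] exceeds the premium and
   is a level. The shift by 2 makes [c 0] positive. *)
pose c n : R := 1 - n.+2%:R^-1.
have c0 n : 0 < c n by rewrite subr_gt0 invf_lt1 ?ltr1n ?ltr0n.
have c1 n : c n < 1 by rewrite gtrBl invr_gt0 ltr0n.
have cc : c n @[n --> \oo] --> (1 : R).
  rewrite -[X in _ --> X]subr0; apply: cvgB; first exact: cvg_cst.
  by have := @cvg_harmonic R; rewrite -(cvg_shiftS (harmonic : R^nat)).
have cnd : {homo c : n m / (n <= m)%N >-> n <= m}.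
  by move=> n m nm; rewrite lerB// lef_pV2 ?posrE// ler_nat ltnS.
pose g n w := (orlicz_pos Phi (X w / h * c n))%:E.
have gE w : (fun n => g n w) n @[n --> \oo] --> (orlicz_pos Phi (X w / h))%:E.
  apply: cvg_EFin; first by near=> n.
  rewrite /= /comp /=.
  (* Left-continuity is available only at positive points; at the others [orlicz_pos] makes the
     sequence constant. *)
  have [x0|x0] := leP (X w / h) 0.
    rewrite (_ : (fun _ => _) = cst (orlicz_pos Phi (X w / h))).
      exact: cvg_cst.
    apply/funext => n; rewrite /orlicz_pos/= !max_r//.
    by rewrite mulr_le0_ge0// ltW.
  rewrite (_ : (fun _ => _) = (fun n => Phi (X w / h * c n))); last first.
    by apply/funext => n; rewrite /orlicz_pos/= max_l// mulr_ge0// ltW.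
  rewrite /orlicz_pos (max_l (ltW x0)).
  have /cvg_at_leftP := orlicz_left_continuous hPhi x0.
  apply; split => [n|]; first by rewrite gtr_pMr.
  by rewrite -[X in _ --> X]mulr1; apply: cvgM cc; exact: cvg_cst.
have mg n : measurable_fun setT (g n).
  apply: measurable_orlicz_pos => //; apply: measurable_funM => //.
  exact: measurable_funM.
have gnd w : {homo g^~ w : n m / (n <= m)%N >-> (n <= m)%E}.
  move=> n m nm; rewrite lee_fin; have [x0|x0] := leP (X w / h) 0.
    rewrite /orlicz_pos !max_r//.
    - by rewrite mulr_le0_ge0// ltW.
    - by rewrite mulr_le0_ge0// ltW.
  by apply: orlicz_pos_nondecreasing => //; rewrite ler_pM2l// cnd.
rewrite (_ : (fun w => _) = fun w => limn (g^~ w)); last first.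
  by apply/funext => w; apply/esym/cvg_lim => //; exact: gE.
have cvgI := cvg_monotone_convergence (mu := P) measurableT mg
  (fun n w _ => orlicz_pos_ge0 hPhi _) (fun w _ => gnd w).
rewrite -(cvg_lim _ cvgI)//; apply: lime_le.
  by apply/cvg_ex; eexists; exact: cvgI.
apply: nearW => n; have := @orlicz_levels_gt (h / c n).
rewrite Hh lte_fin ltr_pdivlMr// gtr_pMr// => /(_ (c1 n))[hc].
rewrite expectation_orlicz ?divr_gt0//; congr (_ <= _)%E.
by apply: eq_integral => w _; rewrite /g invf_div mulrA mulrAC.
Unshelve. all: by end_near.
Qed.

(** Both sides say that 1 is a level: if the premium is below 1 because levels form an up-set, and
    if it equals 1 because a positive premium is attained. *)
Lemma orlicz_premium_le1 : (H <= 1)%E <-> ('E_P[fun w => Phi (X w)] <= 1)%E.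
Proof.
have E1 : (fun w => Phi (X w)) = (fun w => Phi (X w / 1)).
  by apply/funext => w; rewrite divr1.
rewrite E1; split => [H1|E]; last exact: orlicz_premium_le.
suff: orlicz_levels P Phi X 1 by case.
move: H1; rewrite le_eqVlt => /orP[/eqP H1|]; last exact: orlicz_levels_gt.
exact: orlicz_levels_premium.
Qed.

(** Membership in the Orlicz space is phrased with the absolute value of [X], which equals [X]
    almost everywhere; it therefore provides a level. *)
Lemma orlicz_premium_fin :
  (exists2 k, 0 < k & ('E_P[fun w => Phi (`|X w| / k)] <= 1)%E) ->
  exists2 h, 0 <= h & H = h%:E.
Proof.
move=> [k k0 Ek].
have Xk : orlicz_levels P Phi X k.
  split => //; apply: le_trans Ek; rewrite unlock.
  rewrite (@integral_ae_congr _ _ _ P _ (fun w => (Phi (`|X w| / k))%:E))//.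
  by apply: filterS X0 => w Xw; rewrite ger0_norm.
have := orlicz_premium_ge0; have := orlicz_premium_le Xk.
by case: H => [r _ r0|//|//]; exists r.
Qed.

End premium.

(** * Sierpinski's theorem for nonatomic probabilities *)

Section sierpinski.
Context {d : measure_display} {T : measurableType d} {R : realType}.
Variable P : probability T R.
Hypothesis hP : nonatomic P.
Implicit Types A B C D : set T.

Let p A : R := fine (P A).

Let pE A : measurable A -> P A = (p A)%:E.
Proof. by move=> mA; rewrite fineK// fin_num_measure. Qed.

Let pD A B : measurable A -> measurable B -> B `<=` A ->
  p (A `\` B) = p A - p B.
Proof.
move=> mA mB BA; apply: EFin_inj; rewrite EFinB -!pE//; last exact: measurableD.
rewrite measureD ?setIidr// ltey_eq fin_num_measure//.
Qed.

Let pU A B : measurable A -> measurable B -> [disjoint A & B] ->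
  p (A `|` B) = p A + p B.
Proof.
move=> mA mB /disj_set2P AB; apply: EFin_inj; rewrite EFinD -!pE ?measureU//.
exact: measurableU.
Qed.

Let le_p A B : measurable A -> measurable B -> A `<=` B -> p A <= p B.
Proof. by move=> mA mB AB; rewrite -lee_fin -!pE// le_measure ?inE. Qed.

(** A set of strictly intermediate measure splits [A] into two parts of positive measure, one of
    which has at most half the measure of [A]. *)
Lemma nonatomic_half A : measurable A -> 0 < p A ->
  exists B, [/\ measurable B, B `<=` A, 0 < p B & p B <= p A / 2].
Proof.
move=> mA A0; have [|B [mB BA B0 BltA]] := hP mA; first by rewrite pE.
move: B0 BltA; rewrite !pE// !lte_fin => B0 BltA.
have [pB|pB] := leP (p B) (p A / 2); first by exists B.
exists (A `\` B); split => //; first exact: measurableD.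
- by rewrite pD// subr_gt0.
- by rewrite pD//; lra.
Qed.

Lemma nonatomic_small A e : measurable A -> 0 < p A -> 0 < e ->
  exists B, [/\ measurable B, B `<=` A, 0 < p B & p B < e].
Proof.
move=> mA A0 e0.
have small n : exists B,
    [/\ measurable B, B `<=` A, 0 < p B & p B <= 1 / 2 ^+ n].
  elim: n => [|n [B [mB BA B0 Bn]]].
    exists A; split => //; rewrite expr0 divr1 -lee_fin -pE//.
    exact: probability_le1.
  have [C [mC CB C0 CB2]] := nonatomic_half mB B0.
  exists C; split => //; first exact: subset_trans BA.
  by rewrite (le_trans CB2)// exprSr invfM mulrA ler_pM2r.
have [n _ /(_ n (leqnn n))/= en] := near_infty_natSinv_expn_lt (PosNum e0).
have [B [mB BA B0 Bn]] := small n; exists B; split => //.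
exact: le_lt_trans en.
Qed.

(** Subsets of measure at most [t] are enlarged greedily, and their union has measure at most [t].
    Were it less, some [C] of positive measure outside the union would fit into the gap and could be
    added at every stage. But what can be added is at most twice the next increment, and the
    increments tend to 0. *)
Lemma sierpinski A (t : R) : measurable A -> 0 <= t -> (t%:E <= P A)%E ->
  exists B, [/\ measurable B, B `<=` A & P B = t%:E].
Proof.
move=> mA t0; rewrite pE// lee_fin => tA.
pose ok B := [/\ measurable B, B `<=` A & p B <= t].
pose add B C := [/\ measurable C, C `<=` A `\` B & p B + p C <= t].
(* greedy choice: C adds to B at least half of what can be added at all *)
have step B : exists C, ok B ->
    [/\ ok C, B `<=` C & forall D, add B D -> p D <= 2 * (p C - p B)].
  have [[mB BA Bt]|nB] := pselect (ok B); last by exists B.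
  pose S := [set p C | C in add B].
  have S0 : S (p set0).
    by exists set0 => //; split => //; rewrite /p measure0 addr0.
  have Sub : has_ubound S.
    exists t => _ [C [_ _ BCt] <-].
    by rewrite (le_trans _ BCt)// lerDr fine_ge0.
  have hS : has_sup S by split => //; exists (p set0).
  (* If the supremum is not positive, only null sets can be added, and [B] itself serves. *)
  have [S_le0|S_gt0] := leP (sup S) 0.
    exists B => _; split => // D BD; rewrite subrr mulr0 (le_trans _ S_le0)//.
    by apply: ub_le_sup => //; exists D.
  have [_ [C [mC CAB BCt] <-] SC] :=
    sup_adherent (divr_gt0 S_gt0 (ltr0Sn _ 1)) hS.
  have BC : [disjoint B & C].
    by apply/disj_set2P; rewrite -subset0 => x [Bx /CAB[_]].
  exists (B `|` C) => _; split.
  - split; first exact: measurableU.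
      by move=> x [/BA//|/CAB[]].
    by rewrite pU.
  - exact: subsetUl.
  - move=> D BD; have : p D <= sup S by apply: ub_le_sup => //; exists D.
    by rewrite pU//; lra.
have {step}[next nextP] := choice step.
pose F n := iter n next set0.
have okF n : ok (F n).
  elim: n => [|n okn]; last by have [] := nextP _ okn.
  by split; [exact: measurable0|exact: sub0set|rewrite /p measure0].
have FS n : F n `<=` F n.+1 by have [] := nextP _ (okF n).
have mF n : measurable (F n) by have [] := okF n.
have mFU : measurable (\bigcup_n F n) by exact: bigcupT_measurable.
have Fnd : {homo F : n m / (n <= m)%N >-> (n <= m)%O}.
  by apply/nondecreasing_seqP => n; apply/subsetPset.
have pF : p (F n) @[n --> \oo] --> p (\bigcup_n F n).
  by apply: fine_cvg; rewrite -pE//; exact: nondecreasing_cvg_mu.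
have FUA : \bigcup_n F n `<=` A by move=> x [n _]; have [_ + _] := okF n; apply.
have FUt : p (\bigcup_n F n) <= t.
  apply: (@cvgr_to_le _ _ _ _ _ _ _ pF).
  by apply: nearW => n; have [] := okF n.
exists (\bigcup_n F n); split => //; rewrite pE//; congr EFin.
apply/eqP; rewrite eq_le FUt leNgt; apply/negP => FUlt.
have [|||C [mC CAF C0 Ct]] := @nonatomic_small (A `\` \bigcup_n F n)
    (t - p (\bigcup_n F n)).
- exact: measurableD.
- by rewrite pD// subr_gt0 (lt_le_trans FUlt).
- by rewrite subr_gt0.
have addC n : add (F n) C.
  split => //.
    by move=> x /CAF[Ax Fx]; split => // Fnx; apply: Fx; exists n.
  have : p (F n) <= p (\bigcup_n F n) by apply: le_p => //; exact: bigcup_sup.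
  by move: Ct; lra.
have : p C <= 0; last by rewrite leNgt C0.
have cvg0 : 2 * (p (F n.+1) - p (F n)) @[n --> \oo] -->
    2 * (p (\bigcup_n F n) - p (\bigcup_n F n)).
  apply: cvgM; [exact: cvg_cst|apply: cvgB => //].
  by have := pF; rewrite -(cvg_shiftS (p \o F)).
rewrite -(mulr0 2) -(subrr (p (\bigcup_n F n))).
apply: (@cvgr_to_ge _ _ _ _ _ _ _ cvg0).
by apply: nearW => n; have [_ _ +] := nextP _ (okF n); exact.
Qed.

End sierpinski.

(** * From midpoint convexity and left-continuity to convexity *)

Section midpoint_convex.
Context {R : realType}.
Variable f : R -> R.
Hypothesis fl : forall x, 0 < x -> f y @[y --> x^'-] --> f x.
Hypothesis fmid : forall x y, 0 <= x -> 0 <= y ->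
  f ((x + y) / 2) <= (f x + f y) / 2.

(** The parameters where [f] lies below its chord contain 0 and 1 and are closed under midpoints, so
    bisection yields such parameters tending to [t] from below. Because [x < y], the corresponding
    points approach their limit from the left. *)
Lemma midpoint_convex_lt x y t : 0 <= x -> x < y -> 0 <= t -> t <= 1 ->
  f (x + t * (y - x)) <= f x + t * (f y - f x).
Proof.
move=> x0 xy t0 t1; have yx0 : 0 < y - x by rewrite subr_gt0.
move: t0; rewrite le_eqVlt => /orP[/eqP<-|t0]; first by rewrite !mul0r !addr0.
pose ok a := f (x + a * (y - x)) <= f x + a * (f y - f x).
have ok_mid a b : 0 <= a -> 0 <= b -> ok a -> ok b -> ok ((a + b) / 2).
  rewrite /ok => a0 b0 oka okb.
  have := @fmid (x + a * (y - x)) (x + b * (y - x)).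
  rewrite !addr_ge0 ?mulr_ge0// ?(ltW yx0)// => /(_ isT isT).
  rewrite (_ : (_ + _) / 2 = x + (a + b) / 2 * (y - x)); last by field.
  by move=> /le_trans; apply; lra.
(* The left endpoints of the bisection intervals lie strictly below t, so
   left-continuity suffices to pass to the limit. *)
have bisect n : exists a, [/\ 0 <= a, a < t, t <= a + 2 ^- n, ok a &
    ok (a + 2 ^- n)].
  elim: n => [|n [a [a0 at_ ta oka okb]]].
    exists 0; split => //; rewrite ?expr0 ?invr1 ?add0r//.
      by rewrite /ok !mul0r !addr0.
    by rewrite /ok !mul1r !subrKC.
  have e0 : 0 < 2 ^- n.+1 :> R by rewrite invr_gt0 exprn_gt0.
  have e2 : 2 ^- n = 2 ^- n.+1 + 2 ^- n.+1 :> R.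
    by rewrite exprS invfM; field; rewrite expf_neq0.
  have okm : ok (a + 2 ^- n.+1).
    rewrite (_ : a + _ = (a + (a + 2 ^- n)) / 2); last by rewrite e2; field.
    by apply: ok_mid => //; rewrite e2; lra.
  have [tm|tm] := leP t (a + 2 ^- n.+1); first by exists a.
  by exists (a + 2 ^- n.+1); rewrite -addrA -e2; split => //; lra.
have {bisect}[a aP] := choice bisect.
have cvga : a n @[n --> \oo] --> t.
  have cvgt : t - 2 ^- n @[n --> \oo] --> t.
    rewrite -[X in _ --> X]subr0; apply: cvgB; first exact: cvg_cst.
    under eq_fun do rewrite -exprVn.
    by apply: cvg_expr; rewrite ger0_norm ?invr_ge0// invf_lt1// ltr1n.
  apply: (squeeze_cvgr _ cvgt (cvg_cst t)); apply: nearW => n.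
  by have [_ /ltW -> + _ _] := aP n; rewrite lerBlDr => ->.
have xt0 : 0 < x + t * (y - x) by rewrite ltr_wpDl// mulr_gt0.
have /cvg_at_leftP/(_ (fun n => x + a n * (y - x))) := fl xt0.
have cvgx : x + a n * (y - x) @[n --> \oo] --> x + t * (y - x).
  by apply: cvgD; [exact: cvg_cst|apply: cvgM => //; exact: cvg_cst].
have cvgf : f x + a n * (f y - f x) @[n --> \oo] --> f x + t * (f y - f x).
  by apply: cvgD; [exact: cvg_cst|apply: cvgM => //; exact: cvg_cst].
move=> fcvg; apply: (ler_cvg_to (fcvg _) cvgf).
  by split => // n; have [_ an _ _ _] := aP n; rewrite ltrD2l ltr_pM2r.
by apply: nearW => n; have [] := aP n.
Qed.

Lemma midpoint_convex : convex_on_nonneg f.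
Proof.
suff conv (x y t : R) : 0 <= x -> 0 <= y -> 0 <= t -> t <= 1 ->
    f (t * x + (1 - t) * y) <= t * f x + (1 - t) * f y.
  move=> t x y; rewrite !inE/= !in_itv/= !andbT => x0 y0.
  by apply: conv.
(* The chord is parametrized from the smaller endpoint, so its parameter is the weight of the larger
   one: [1 - t] if [x < y], and [t] if [y < x]. *)
move=> x0 y0 t0 t1; have [xy|yx|->] := ltgtP x y.
- have := @midpoint_convex_lt x y (1 - t) x0 xy; rewrite subr_ge0 lerBlDl lerDr.
  move=> /(_ t1 t0); congr (f _ <= _); ring.
- have := @midpoint_convex_lt y x t y0 yx t0 t1.
  congr (f _ <= _); ring.
- by rewrite -!mulrDl subrKC !mul1r.
Qed.

End midpoint_convex.

(** * Constants, homogeneity, monotonicity, law-invariance and sufficiency of convexity *)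

Section parts.
Context {d : measure_display} {T : measurableType d} {R : realType}.
Variables (P : probability T R) (Phi : R -> R).
Hypothesis hPhi : generalized_orlicz Phi.
Implicit Types (X Y : T -> R) (c h k : R).
Local Notation H := (orlicz_premium P Phi).

Lemma orlicz_premium_cst c : 0 <= c -> H (fun=> c) = c%:E.
Proof.
move=> c0.
have levE k : orlicz_levels P Phi (fun=> c) k <-> 0 < k /\ Phi (c / k) <= 1.
  by rewrite /orlicz_levels/= expectation_cst lee_fin.
apply/eqP; rewrite eq_le; apply/andP; split.
  (* The margin [e] is there for [c = 0], where the infimum 0 is not a level. *)
  apply/lee_addgt0Pr => e e0; apply: orlicz_premium_le; apply/levE.
  have ce0 : 0 < c + e by rewrite ltr_wpDl.
  split=> //; apply: (orlicz_le1 hPhi); first by rewrite divr_ge0// ltW.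
  by rewrite ler_pdivrMr// mul1r lerDl ltW.
apply/ereal_infP => _ [k /levE[k0 ck] <-].
rewrite lee_fin leNgt; apply/negP => kc.
by move: ck; rewrite leNgt (orlicz_gt1 hPhi)// ltr_pdivlMr// mul1r.
Qed.

Lemma orlicz_levelsZ X c k : 0 < c ->
  orlicz_levels P Phi (fun w => c * X w) k <-> orlicz_levels P Phi X (k / c).
Proof.
move=> c0; rewrite /orlicz_levels/= pmulr_lgt0 ?invr_gt0//.
rewrite (_ : (fun w => Phi (X w / (k / c))) = fun w => Phi (c * X w / k))//.
by apply/funext => w; rewrite invf_div mulrA mulrAC mulrC mulrA.
Qed.

(** For [c > 0] the levels of [c * X] are those of [X] multiplied by [c]; for [c = 0] the variable
    is the constant 0. *)
Lemma orlicz_premiumZ X c h : measurable_fun setT X ->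
  {ae P, forall w, 0 <= X w} -> H X = h%:E -> 0 <= c ->
  H (fun w => c * X w) = (c%:E * H X)%E.
Proof.
move=> mX X0 Xh; rewrite le_eqVlt => /orP[/eqP<-|c0].
  by under eq_fun do rewrite mul0r; rewrite orlicz_premium_cst// mul0e.
rewrite Xh -EFinM; apply/eqP; rewrite eq_le; apply/andP; split.
  apply/lee_addgt0Pr => e e0; apply: orlicz_premium_le.
  apply/orlicz_levelsZ => //.
  apply: orlicz_levels_gt => //.
  by rewrite Xh lte_fin ltr_pdivlMr// mulrC ltrDl.
apply/ereal_infP => _ [k /(orlicz_levelsZ _ _ c0) Xk <-].
by have := orlicz_premium_le Xk; rewrite Xh !lee_fin ler_pdivlMr// mulrC.
Qed.

Lemma orlicz_premium_ae_le X Y : {ae P, forall w, 0 <= X w} ->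
  {ae P, forall w, 0 <= Y w} -> {ae P, forall w, X w <= Y w} ->
  (H X <= H Y)%E.
Proof.
move=> X0 Y0 XY; apply/ereal_infP => _ [k [k0 Yk] <-].
apply: orlicz_premium_le; split => //; apply: le_trans Yk.
rewrite !expectation_orlicz//.
apply: ge0_integral_ae_le => [w|w|]; rewrite ?lee_fin ?orlicz_pos_ge0//.
apply: filterS XY => w XYw; rewrite lee_fin orlicz_pos_nondecreasing//.
by rewrite ler_pM2r// invr_gt0.
Qed.

(** By change of variables the expectation at each [k] is an integral against the distribution, so
    [X] and [Y] have the same levels. *)
Lemma orlicz_premium_distribution (X Y : {RV P >-> R}) :
  {ae P, forall w, 0 <= X w} -> {ae P, forall w, 0 <= Y w} ->
  (forall A, measurable A -> distribution P X A = distribution P Y A) ->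
  H X = H Y.
Proof.
move=> X0 Y0 XY; congr (ereal_inf (_ @` _)); apply/seteqP.
have E k : 0 < k ->
    ('E_P[fun w => Phi (X w / k)] = 'E_P[fun w => Phi (Y w / k)])%E.
  move=> k0; rewrite !expectation_orlicz//.
  pose F x := (orlicz_pos Phi (x / k))%:E.
  have mF : measurable_fun setT F.
    by apply: measurable_orlicz_pos => //; exact: measurable_funM.
  have F0 x : (0 <= F x)%E by rewrite lee_fin orlicz_pos_ge0.
  rewrite -[LHS](ge0_integral_distribution X mF F0).
  rewrite -[RHS](ge0_integral_distribution Y mF F0).
  by apply: eq_measure_integral => A mA _; exact: XY.
by split=> k [k0 Ek]; split => //; rewrite -?E// E.
Qed.

Lemma convex_on_nonneg_le t x y : convex_on_nonneg Phi -> 0 <= t -> t <= 1 ->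
  0 <= x -> 0 <= y ->
  Phi (t * x + (1 - t) * y) <= t * Phi x + (1 - t) * Phi y.
Proof.
move=> cPhi t0 t1 x0 y0.
have t01 : Itv.spec (@Itv.num_sem R) (Itv.Real `[0%Z, 1%Z]) t.
  by rewrite /= /Itv.num_sem/= in_itv/= num_real t0 t1.
have := cPhi (Itv.mk t01) x y; apply; rewrite inE/= in_itv/= andbT//.
Qed.

Lemma convex_orlicz_premium : convex_on_nonneg Phi -> premium_convex P Phi.
Proof.
move=> cPhi X Y t [/= spX X0] [/= spY Y0] t0 t1.
have mX : measurable_fun setT X by [].
have mY : measurable_fun setT Y by [].
have [a a0 Xa] := orlicz_premium_fin X0 spX.
have [b b0 Yb] := orlicz_premium_fin Y0 spY.
rewrite Xa Yb -!EFinM -EFinD; apply/lee_addgt0Pr => e e0; rewrite -EFinD.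
(* Being strictly above the premiums, [u] and [v] are levels even if a premium vanishes. Since the
   weights sum to 1, the combination of [u] and [v] exceeds that of [a] and [b] by exactly [e]. *)
pose u := a + e; pose v := b + e.
have [u0 XE] : orlicz_levels P Phi X u.
  by apply: orlicz_levels_gt => //; rewrite Xa lte_fin ltrDl.
have [v0 YE] : orlicz_levels P Phi Y v.
  by apply: orlicz_levels_gt => //; rewrite Yb lte_fin ltrDl.
pose k := t * u + (1 - t) * v.
have -> : t * a + (1 - t) * b + e = k by rewrite /k /u /v; ring.
have k0 : 0 < k.
  rewrite /k; move: t0; rewrite le_eqVlt => /orP[/eqP<-|t0].
    by rewrite mul0r add0r subr0 mul1r.
  by rewrite ltr_pwDl ?mulr_gt0// mulr_ge0 ?subr_ge0// ltW.
(* The weight for which [(t * X + (1 - t) * Y) / k] equals [s * (X / u) + (1 - s) * (Y / v)]. *)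
pose s := t * u / k.
have s0 : 0 <= s by rewrite /s divr_ge0 ?mulr_ge0// ltW.
have s1E : 1 - s = (1 - t) * v / k.
  rewrite /s -[X in X - _](@divff _ k) ?gt_eqF// -mulrBl; congr (_ / _).
  by rewrite /k; ring.
have s1 : 0 <= 1 - s by rewrite s1E divr_ge0 ?mulr_ge0 ?subr_ge0// ltW.
apply: orlicz_premium_le; split => //.
have Z0 : {ae P, forall w, 0 <= t * X w + (1 - t) * Y w}.
  by apply: filterS2 X0 Y0 => w Xw Yw; rewrite addr_ge0// mulr_ge0// subr_ge0.
move: XE YE; rewrite !expectation_orlicz// => XE YE.
have mXu := measurable_orlicz_div hPhi mX u.
have mYv := measurable_orlicz_div hPhi mY v.
apply: (@le_trans _ _ (\int[P]_w (s%:E * (orlicz_pos Phi (X w / u))%:E +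
                                  (1 - s)%:E * (orlicz_pos Phi (Y w / v))%:E))%E).
  apply: ge0_integral_ae_le => [w|w|].
  - by rewrite lee_fin orlicz_pos_ge0.
  - by rewrite lee_fin addr_ge0// mulr_ge0// orlicz_pos_ge0.
  apply: filterS2 X0 Y0 => w Xw Yw; rewrite -!EFinM -EFinD lee_fin.
  rewrite /orlicz_pos !max_l ?divr_ge0 ?(ltW u0) ?(ltW v0) ?(ltW k0)//; last first.
    by rewrite addr_ge0// mulr_ge0// subr_ge0.
  have := @convex_on_nonneg_le s (X w / u) (Y w / v) cPhi s0.
  rewrite -[s <= 1]subr_ge0 s1 !divr_ge0 ?(ltW u0) ?(ltW v0)// => /(_ isT isT isT).
  congr (Phi _ <= _); rewrite s1E /s; field.
  by rewrite !gt_eqF.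
rewrite ge0_integralD//=; first last.
- exact: measurable_funeM.
- by move=> w _; rewrite lee_fin mulr_ge0// orlicz_pos_ge0.
- exact: measurable_funeM.
- by move=> w _; rewrite lee_fin mulr_ge0// orlicz_pos_ge0.
rewrite !ge0_integralZl//=; last 2 first.
- by move=> w _; rewrite lee_fin orlicz_pos_ge0.
- by move=> w _; rewrite lee_fin orlicz_pos_ge0.
apply: (@le_trans _ _ (s%:E * 1 + (1 - s)%:E * 1)%E).
  by apply: leeD; apply: lee_wpmul2l; rewrite ?lee_fin.
by rewrite !mule1 -EFinD subrKC.
Qed.

End parts.

(** * The equation defining the premium of a bounded random variable *)

Section bounded.
Context {d : measure_display} {T : measurableType d} {R : realType}.
Variables (P : probability T R) (Phi : R -> R).
Hypothesis hPhi : generalized_orlicz Phi.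
Hypothesis incPhi : forall x y, 0 <= x -> x < y -> Phi x < Phi y.
Hypothesis cPhi : {within `[0, +oo[, continuous Phi}.
Variable X : T -> R.
Hypotheses (mX : measurable_fun setT X) (X0 : {ae P, forall w, 0 <= X w}).
Local Notation H := (orlicz_premium P Phi X).

Lemma Lfun_oo_ae_le (Y : T -> R) : Y \in Lfun P +oo%E ->
  exists2 M : R, 0 <= M & {ae P, forall w, `|Y w| <= M}.
Proof.
move=> /sub_Lfun_finLfun; rewrite inE /finite_norm unlock.
rewrite /= probability_setT lte01 => YM.
(* The bound is the essential supremum of the absolute value, finite by membership. *)
exists (fine (ess_sup P (abse \o (EFin \o Y)))).
  apply/fine_ge0; apply: ess_sup_gee; first by rewrite /= probability_setT.
  by apply: aeW => w; exact: abse_ge0.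
apply: filterS (ess_sup_ge P (abse \o (EFin \o Y))) => w /=.
by move: YM; case: ess_sup => [r _|//|//]; rewrite ?lee_fin.
Qed.

Lemma orlicz_pos_cvg (u : R^nat) x : (forall n, 0 < u n) ->
  u n @[n --> \oo] --> (1 : R) ->
  orlicz_pos Phi (x * u n) @[n --> \oo] --> orlicz_pos Phi x.
Proof.
move=> u0 u1; have [x0|x0] := leP x 0.
  rewrite (_ : (fun _ => _) = cst (orlicz_pos Phi x)); first exact: cvg_cst.
  apply/funext => n; rewrite /orlicz_pos/= !max_r//.
  by rewrite mulr_le0_ge0// ltW.
rewrite (_ : (fun _ => _) = (fun n => Phi (x * u n))); last first.
  by apply/funext => n; rewrite /orlicz_pos/= max_l// mulr_ge0// ltW.
rewrite /orlicz_pos (max_l (ltW x0)).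
have /continuous_within_itvcyP[cx _] := cPhi.
have xu : x * u n @[n --> \oo] --> x.
  by rewrite -[X in _ --> X]mulr1; apply: cvgM u1; exact: cvg_cst.
apply: cvg_comp xu _; apply: cx.
by rewrite in_itv/= andbT.
Qed.

Lemma expectation_orlicz_premium h (M : R) : 0 <= M ->
  {ae P, forall w, `|X w| <= M} ->
  0 < h -> H = h%:E -> 'E_P[fun w => Phi (X w / h)]%E = 1%E.
Proof.
move=> M0 XM h0 Hh; have [_ Eh] := orlicz_levels_premium hPhi mX X0 h0 Hh.
apply/eqP; rewrite eq_le Eh leNgt; apply/negP => Elt.
(* Now [h / c n] lies strictly below the premium, so it is not a level and its expectation exceeds
   1; this passes to the limit [h]. *)
pose c n : R := 1 + n.+1%:R^-1.
have c1 n : 1 < c n by rewrite ltrDl invr_gt0.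
have c0 n : 0 < c n by exact: lt_trans (c1 n).
have c2 n : c n <= 2 by rewrite /c lerD2l invf_le1// ler1n.
have cc : c n @[n --> \oo] --> (1 : R).
  rewrite -[X in _ --> X]addr0; apply: cvgD; first exact: cvg_cst.
  exact: cvg_harmonic.
pose g n w := (orlicz_pos Phi (X w / h * c n))%:E.
have mg n : measurable_fun setT (g n).
  apply: measurable_orlicz_pos => //; apply: measurable_funM => //.
  exact: measurable_funM.
(* The dominating constant comes from [X <= M] almost surely and [c n <= 2]. *)
pose G := orlicz_pos Phi (M / h * 2).
have [|||_ _ cvgI] := @dominated_convergence _ _ _ P _ measurableT g
  (fun w => (orlicz_pos Phi (X w / h))%:E) (cst G%:E) mg
  (measurable_orlicz_div hPhi mX h).
- apply: aeW => w _; apply: cvg_EFin; first exact: nearW.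
  exact: orlicz_pos_cvg.
- exact: finite_measure_integrable_cst.
- apply: filterS2 X0 XM => w Xw; rewrite ger0_norm// => XwM n _.
  rewrite gee0_abs ?lee_fin ?orlicz_pos_ge0// orlicz_pos_nondecreasing//.
  apply: ler_pM => //; rewrite ?divr_ge0 ?(ltW h0) ?(ltW (c0 n))//.
  by rewrite ler_pM2r ?invr_gt0.
have En n : (1 < \int[P]_w g n w)%E.
  rewrite ltNge; apply/negP => gn1.
  have /orlicz_premium_le : orlicz_levels P Phi X (h / c n).
    split; first by rewrite divr_gt0.
    rewrite expectation_orlicz ?divr_gt0//; apply: le_trans gn1.
    rewrite le_eqVlt; apply/orP; left; apply/eqP/eq_integral => w _.
    by rewrite /g invf_div mulrA mulrAC.
  by rewrite Hh lee_fin leNgt ltr_pdivrMr// ltr_pMr// c1.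
have : (1 <= \int[P]_w (orlicz_pos Phi (X w / h))%:E)%E.
  rewrite -(cvg_lim _ cvgI)//; apply: lime_ge.
    by apply/cvg_ex; eexists; exact: cvgI.
  by apply: nearW => n; exact: ltW (En n).
by rewrite -expectation_orlicz// leNgt Elt.
Qed.

(** Any solution [k] is a level, so [h <= k]. If [h < k], the integrands at [h] and [k] are ordered
    and have equal finite integrals, hence agree almost everywhere; strict monotonicity then forces
    [X = 0] almost everywhere. But then [h / 2] is a level below the premium. *)
Lemma expectation_orlicz_inj h k : 0 < h -> H = h%:E ->
  0 < k -> 'E_P[fun w => Phi (X w / h)]%E = 1%E ->
  'E_P[fun w => Phi (X w / k)]%E = 1%E -> k = h.
Proof.
move=> h0 Hh k0 Eh Ek; apply/eqP.
have Xk : orlicz_levels P Phi X k by split; rewrite ?Ek.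
have := orlicz_premium_le Xk; rewrite Hh lee_fin le_eqVlt eq_sym => /orP[//|hk].
exfalso; move: Eh Ek; rewrite !expectation_orlicz// => Eh Ek.
pose F l w := (orlicz_pos Phi (X w / l))%:E.
have mF l : measurable_fun setT (F l) by exact: measurable_orlicz_div.
have F0 l w : (0 <= F l w)%E by rewrite lee_fin orlicz_pos_ge0.
have iF l : (\int[P]_w F l w = 1)%E -> P.-integrable setT (F l).
  move=> El; apply/integrableP; split => //.
  by under eq_integral do rewrite gee0_abs//; rewrite El ltry.
have int0 : (\int[P]_w `|F h w - F k w| = 0)%E.
  rewrite (integral_ae_congr (g := fun w => F h w - F k w))%E; last first.
    apply: filterS X0 => w Xw; rewrite gee0_abs// sube_ge0// lee_fin.
    by rewrite orlicz_pos_nondecreasing// ler_wpM2l// lef_pV2// ltW.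
  by rewrite integralB//; [rewrite Eh Ek subee|exact: iF|exact: iF].
have mFB : measurable_fun setT (fun w => F h w - F k w)%E.
  exact: emeasurable_funB.
have /ae_eq_integral_abs := int0; move=> /(_ measurableT mFB) FB0.
have Xle0 : {ae P, forall w, X w = 0}.
  apply: filterS2 X0 FB0 => w Xw /(_ I) [/eqP].
  rewrite subr_eq0 => /eqP; rewrite /orlicz_pos.
  rewrite !max_l ?divr_ge0 ?(ltW h0) ?(ltW k0)// => Phihk.
  move: Xw; rewrite le_eqVlt => /orP[/eqP//|Xw].
  have := @incPhi (X w / k) (X w / h).
  rewrite Phihk ltxx divr_ge0 ?(ltW Xw) ?(ltW k0)//.
  by rewrite ltr_pM2l// ltf_pV2// => /(_ isT hk).
have h20 : 0 < h / 2 by rewrite divr_gt0.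
have /orlicz_premium_le : orlicz_levels P Phi X (h / 2).
  split => //; rewrite expectation_orlicz//.
  rewrite (integral_ae_congr (g := fun=> (orlicz_pos Phi 0)%:E)); last first.
    by apply: filterS Xle0 => w ->; rewrite mul0r.
  by rewrite integral_cst//= probability_setT mule1 lee_fin orlicz_pos_le0.
by rewrite Hh lee_fin; lra.
Qed.

End bounded.

(** * Random variables with finitely many values *)

Section finite_index.
Context {d : measure_display} {T : measurableType d} {R : realType}.
Variables (P : probability T R) (I : finType) (idx : T -> I).
Hypothesis midx : forall i, measurable (idx @^-1` [set i]).
Variable c : I -> R.

Let cE : c \o idx = fun w => \sum_i c i * \1_(idx @^-1` [set i]) w.
Proof.
apply/funext => w.
rewrite (bigD1 (idx w))//= indicE mem_set// mulr1 big1 ?addr0//.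
move=> i iw; rewrite indicE memNset ?mulr0//= => wi.
by rewrite wi eqxx in iw.
Qed.

Let mterm i : measurable_fun setT (fun w => c i * \1_(idx @^-1` [set i]) w).
Proof. by apply: measurable_funM => //; exact: measurable_indic. Qed.

Lemma measurable_finite_index : measurable_fun setT (c \o idx).
Proof. by rewrite cE; exact: measurable_sum. Qed.

Lemma ge0_integral_finite_index : (forall i, 0 <= c i) ->
  (\int[P]_w (c (idx w))%:E = \sum_i (c i)%:E * P (idx @^-1` [set i]))%E.
Proof.
move=> c0; have cw w :
    (c (idx w))%:E = (\sum_i (c i * \1_(idx @^-1` [set i]) w)%:E)%E.
  by rewrite sumEFin -[c (idx w)]/((c \o idx) w) cE.
under eq_integral do rewrite cw.
rewrite ge0_integral_sum//; last 2 first.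
- by move=> i; exact/measurable_EFinP.
- by move=> i w _; rewrite lee_fin mulr_ge0.
apply: eq_bigr => i _; under eq_integral do rewrite EFinM.
rewrite ge0_integralZl//=.
- by rewrite integral_indic// setIT.
- by apply/measurable_EFinP; exact: measurable_indic.
- by rewrite lee_fin c0.
Qed.

End finite_index.

(** * Partitions into four events of prescribed probabilities *)

Section partition.
Context {d : measure_display} {T : measurableType d} {R : realType}.
Variable P : probability T R.
Hypothesis hP : nonatomic P.

(** Sierpinski's theorem is applied three times, each time inside what the earlier events leave; the
    fourth event is the remainder. *)
Lemma nonatomic_partition (q1 q2 q3 : R) :
  0 <= q1 -> 0 <= q2 -> 0 <= q3 -> q1 + q2 + q3 <= 1 ->
  exists idx : T -> 'I_4, forall i, measurable (idx @^-1` [set i]) /\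
    P (idx @^-1` [set i]) = ([:: q1; q2; q3; 1 - q1 - q2 - q3]`_i)%:E.
Proof.
move=> q10 q20 q30 q1D.
have [|A1 [mA1 _ PA1]] := sierpinski hP measurableT q10.
  by rewrite probability_setT lee_fin; lra.
have mA1C : measurable (~` A1) by exact: measurableC.
have PA1C : P (~` A1) = (1 - q1)%:E by rewrite probability_setC// PA1.
have [|A2 [mA2 A2s PA2]] := sierpinski hP mA1C q20.
  by rewrite PA1C lee_fin; lra.
have mA2C : measurable (~` A1 `\` A2) by exact: measurableD.
have PA2C : P (~` A1 `\` A2) = (1 - q1 - q2)%:E.
  rewrite measureD ?setIidr ?ltey_eq ?fin_num_measure//.
  by rewrite [X in (X - _)%E]PA1C [X in (_ - X)%E]PA2.
have [|A3 [mA3 A3s PA3]] := sierpinski hP mA2C q30.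
  by rewrite PA2C lee_fin; lra.
have PA3C : P (~` A1 `\` A2 `\` A3) = (1 - q1 - q2 - q3)%:E.
  rewrite measureD ?setIidr ?ltey_eq ?fin_num_measure//.
  by rewrite [X in (X - _)%E]PA2C [X in (_ - X)%E]PA3.
pose idx w : 'I_4 := if w \in A1 then inord 0 else if w \in A2 then inord 1
  else if w \in A3 then inord 2 else inord 3.
have idxE (A : set T) (i : 'I_4) : (forall w, A w <-> idx w = i :> nat) ->
    idx @^-1` [set i] = A.
  move=> Ai; apply/seteqP.
  by split=> w /=; rewrite Ai; [move=> ->|move=> /val_inj].
have idxP w : (idx w : nat) = if w \in A1 then 0 else if w \in A2 then 1
  else if w \in A3 then 2 else 3.
  rewrite /idx; case: ifP => _; [|case: ifP => _; [|case: ifP => _]];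
    by rewrite inordK.
exists idx; case=> -[|[|[|[|//]]]] ii /=.
- rewrite (idxE A1)// => w; rewrite idxP/=.
  case: ifPn => [/set_mem//|/negP/= nA1]; split => [/mem_set//|].
  by do 2 (case: ifP => _ //).
- rewrite (idxE A2)// => w; rewrite idxP/=.
  case: ifPn => [/set_mem A1w|/negP/= nA1]; first by split => // /A2s.
  by case: ifPn => [/set_mem//|/negP/= nA2]; split => [/mem_set//|]; case: ifP.
- rewrite (idxE A3)// => w; rewrite idxP/=.
  case: ifPn => [/set_mem A1w|/negP/= nA1]; first by split => // /A3s[].
  case: ifPn => [/set_mem A2w|/negP/= nA2]; first by split => // /A3s[].
  by case: ifPn => [/set_mem//|/negP/= nA3]; split => [/mem_set//|].
- rewrite (idxE (~` A1 `\` A2 `\` A3)) => [|w].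
    by split => //; exact: measurableD.
  rewrite idxP/=.
  case: ifPn => [/set_mem A1w|/negP/= nA1]; first by split => // -[[]].
  case: ifPn => [/set_mem A2w|/negP/= nA2]; first by split => // -[[]].
  case: ifPn => [/set_mem A3w|/negP/= nA3]; first by split => // -[].
  by split => // _; split; [split|] => /mem_set.
Qed.

End partition.

(** * Convexity of the premium forces convexity of [Phi] *)

Section necessity.
Context {d : measure_display} {T : measurableType d} {R : realType}.
Variables (P : probability T R) (Phi : R -> R).
Hypothesis hP : nonatomic P.
Hypothesis hPhi : generalized_orlicz Phi.

Lemma premium_convex_midpoint u x y : 0 <= u -> Phi u < 1 ->
  premium_convex P Phi -> 0 <= x -> 0 <= y ->
  Phi ((x + y) / 2) <= (Phi x + Phi y) / 2.
Proof.
move=> u0 Phiu Hcvx x0 y0.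
have v0 := orlicz_ge0 hPhi u0.
have s1 : 1 < Phi 2 by apply: (orlicz_gt1 hPhi); rewrite ltr1n.
have Phix := orlicz_ge0 hPhi x0.
have Phiy := orlicz_ge0 hPhi y0.
set m := (Phi x + Phi y) / 2.
have m0 : 0 <= m by rewrite divr_ge0// addr_ge0.
have [v vE] : {v | Phi u = v} by exists (Phi u).
have [s sE] : {s | Phi 2 = s} by exists (Phi 2).
rewrite vE sE in v0 Phiu s1.
(* Such a [q] exists because [v < 1 < s]. Using [m + 1] instead of [m] keeps the denominator
   positive when [m = 0]. *)
have [q [q0 qs qm]] : exists q : R, [/\ 0 < q, 2 * q * s <= s - 1 &
    2 * q * (m + 1) <= 1 - v].
  exists (Num.min ((s - 1) / (2 * s)) ((1 - v) / (2 * (m + 1)))); split.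
  - by rewrite lt_min !divr_gt0 ?mulr_gt0 ?subr_gt0 ?addr_ge0 ?ltr_wpDl//; lra.
  - rewrite -mulrA mulrCA -ler_pdivlMr ?mulr_gt0 ?ge_min ?lexx//; lra.
  - by rewrite -mulrA mulrCA -ler_pdivlMr ?mulr_gt0 ?ltr_wpDl// ge_min lexx orbT.
(* r solves q Phi(x) + q Phi(y) + r v + (1 - 2 q - r) s = 1; the bounds on q
   amount to 0 <= r <= 1 - 2 q. *)
pose r := (2 * q * m + (1 - 2 * q) * s - 1) / (s - v).
have sv : 0 < s - v by lra.
have rE : r * (s - v) = 2 * q * m + (1 - 2 * q) * s - 1.
  by rewrite /r divfK// gt_eqF.
have qm0 : 0 <= q * m by rewrite mulr_ge0// ltW.
have qv0 : 0 <= q * v by rewrite mulr_ge0// ltW.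
have r0 : 0 <= r by rewrite -(pmulr_lge0 _ sv) rE; lra.
have r1 : r <= 1 - 2 * q by rewrite -(ler_pM2r sv) rE; lra.
have [|idx idxP] := nonatomic_partition hP (ltW q0) (ltW q0) r0; first lra.
have midx i : measurable (idx @^-1` [set i]) by have [] := idxP i.
(* The variables used are [c x y \o idx], [c y x \o idx] and, with [z] the midpoint of [x] and [y],
   their average [c z z \o idx]. *)
pose c (a b : R) (i : 'I_4) := [:: a; b; u; 2]`_i.
have c0 a b i : 0 <= a -> 0 <= b -> 0 <= c a b i.
  by move=> a0 b0; case: i => -[|[|[|[|//]]]].
have mc a b := measurable_finite_index midx (c a b).
have EPhi a b : 0 <= a -> 0 <= b ->
    'E_P[fun w => Phi (c a b (idx w))]%E =
    (q * Phi a + q * Phi b + r * v + (1 - q - q - r) * s)%:E.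
  move=> a0 b0; rewrite unlock.
  rewrite (ge0_integral_finite_index P midx (c := fun i => Phi (c a b i))) => [|i].
    rewrite !big_ord_recl big_ord0 !(proj2 (idxP _)) -!EFinM -!EFinD/=.
    by rewrite /c/= vE sE; congr EFin; ring.
  by apply: (orlicz_ge0 hPhi); exact: c0.
(* The expectation depends on [a] and [b] only through [Phi a + Phi b], so one choice of [r] makes
   it 1 for both orders of [x] and [y]. *)
have rv a b : 0 <= a -> 0 <= b -> Phi a + Phi b = 2 * m ->
    exists2 X : {RV P >-> R}, X = c a b \o idx :> (T -> R) &
      orlicz_space_pos P Phi X /\ (orlicz_premium P Phi X <= 1)%E.
  move=> a0 b0 abm.
  pose X : {RV P >-> R} := mfun_Sub (mem_set (mc a b)).
  have XE : X = c a b \o idx :> (T -> R) by [].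
  have X0 w : 0 <= X w by rewrite XE; exact: c0.
  have EX : ('E_P[fun w => Phi (X w)] <= 1)%E.
    rewrite XE EPhi// lee_fin -mulrDr abm.
    by move: rE; lra.
  exists X => //; split; last by apply/orlicz_premium_le1 => //; exact: aeW.
  split; last exact: aeW.
  exists 1 => //; apply: le_trans EX; rewrite le_eqVlt; apply/orP; left.
  by apply/eqP; congr expectation; apply/funext => w; rewrite divr1 ger0_norm.
have [|X XE [Xs X1]] := rv x y x0 y0; first by rewrite /m; field.
have [|Y YE [Ys Y1]] := rv y x y0 x0; first by rewrite /m; field.
have := Hcvx X Y 2^-1 Xs Ys.
rewrite invr_ge0 ler0n invf_le1// ler1n => /(_ isT isT) HXY.
pose z := (x + y) / 2.
have z0 : 0 <= z by rewrite divr_ge0// addr_ge0.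
have ZE : (fun w => 2^-1 * X w + (1 - 2^-1) * Y w) = c z z \o idx.
  apply/funext => w; rewrite XE YE /= /c /z.
  by case: (idx w) => -[|[|[|[|//]]]] ? /=; field.
have : (orlicz_premium P Phi (c z z \o idx) <= 1)%E.
  rewrite -ZE (le_trans HXY)//.
  apply: (@le_trans _ _ ((2^-1)%:E * 1 + (1 - 2^-1)%:E * 1)%E).
    by apply: leeD; apply: lee_wpmul2l => //; rewrite lee_fin; lra.
  by rewrite !mule1 -EFinD subrKC.
rewrite orlicz_premium_le1//; last by apply: aeW => w; exact: c0.
rewrite EPhi// lee_fin -/z => Ez.
(* By the equation for [r], the events with values [u] and 2 contribute [1 - 2 * q * m], which
   leaves [2 * q * Phi z <= 2 * q * m]. *)
rewrite -(ler_pM2l q0); move: rE Ez; lra.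
Qed.

Lemma premium_convex_necessity :
  (exists u : R, [/\ 0 <= u, u < 1 & Phi u < 1]) ->
  premium_convex P Phi -> convex_on_nonneg Phi.
Proof.
move=> [u [u0 _ u1]] Hcvx; apply: midpoint_convex => [|x y].
  exact: (orlicz_left_continuous hPhi).
exact: (premium_convex_midpoint u0).
Qed.

End necessity.

(** In (d) the premium is taken positive because the equation divides by it. *)
Theorem proposition10 (d : measure_display) (T : measurableType d)
    (R : realType) (P : probability T R) (hP : nonatomic P)
    (Phi : R -> R) (hPhi : generalized_orlicz Phi) :
  (* (a) *)
  ((forall X Y : {RV P >-> R},
      orlicz_space_pos P Phi X -> orlicz_space_pos P Phi Y ->
      {ae P, forall w, X w <= Y w} ->
      (orlicz_premium P Phi X <= orlicz_premium P Phi Y)%E) /\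
   (forall (X : {RV P >-> R}) (lam : R),
      orlicz_space_pos P Phi X -> 0 <= lam ->
      orlicz_premium P Phi (fun w => lam * X w)
        = (lam%:E * orlicz_premium P Phi X)%E) /\
   (forall c : R, 0 <= c -> orlicz_premium P Phi (fun=> c) = c%:E)) /\
  (* (b) *)
  (forall X : {RV P >-> R},
     orlicz_space_pos P Phi X -> (0 < orlicz_premium P Phi X)%E ->
     exists m : R,
       [/\ orlicz_levels P Phi X m,
           lbound (orlicz_levels P Phi X) m &
           orlicz_premium P Phi X = m%:E]) /\
  (* (c) *)
  (forall X : {RV P >-> R},
     orlicz_space_pos P Phi X ->
     ((orlicz_premium P Phi X <= 1)%E <->
      ('E_P[fun w => Phi (X w)] <= 1)%E)) /\
  (* (d) *)
  ((forall x y : R, 0 <= x -> x < y -> Phi x < Phi y) ->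
   {within `[0, +oo[, continuous Phi} ->
   forall X : {RV P >-> R},
     orlicz_space_pos P Phi X -> (X : T -> R) \in Lfun P +oo%E ->
     (0 < orlicz_premium P Phi X)%E ->
     exists h : R,
       [/\ 0 < h,
           orlicz_premium P Phi X = h%:E,
           ('E_P[fun w => Phi (X w / h)%R] = 1)%E &
           forall k : R, 0 < k -> ('E_P[fun w => Phi (X w / k)%R] = 1)%E ->
             k = h]) /\
  (* (e) *)
  (convex_on_nonneg Phi -> premium_convex P Phi) /\
  (* (f) *)
  ((exists u : R, [/\ 0 <= u, u < 1 & Phi u < 1]) ->
   premium_convex P Phi -> convex_on_nonneg Phi) /\
  (* (g) *)
  (forall X Y : {RV P >-> R},
     orlicz_space_pos P Phi X -> orlicz_space_pos P Phi Y ->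
     (forall A : set R, measurable A ->
        distribution P X A = distribution P Y A) ->
     orlicz_premium P Phi X = orlicz_premium P Phi Y).
Proof.
split; last split; last split; last split; last split; last split.
- split; [|split] => [X Y [_ X0] [_ Y0]|X c [spX X0] c0|c].
  + exact: orlicz_premium_ae_le.
  + have [h _ Xh] := orlicz_premium_fin X0 spX.
    exact: orlicz_premiumZ Xh c0.
  + exact: orlicz_premium_cst.
- move=> X [spX X0] H0; have [h _ Xh] := orlicz_premium_fin X0 spX.
  move: H0; rewrite Xh lte_fin => h0; exists h; split => //.
    exact: orlicz_levels_premium.
  by move=> k /orlicz_premium_le; rewrite Xh lee_fin.
- by move=> X [_ X0]; exact: orlicz_premium_le1.
- move=> incPhi cPhi X [spX X0] /Lfun_oo_ae_le[M M0 XM] H0.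
  have [h _ Xh] := orlicz_premium_fin X0 spX.
  move: H0; rewrite Xh lte_fin => h0.
  have Eh := expectation_orlicz_premium hPhi cPhi (measurable_funPT X)
    X0 M0 XM h0 Xh.
  exists h; split => // k k0.
  exact: (expectation_orlicz_inj hPhi incPhi (measurable_funPT X) X0 h0 Xh k0
    Eh).
- exact: convex_orlicz_premium.
- exact: premium_convex_necessity.
- by move=> X Y [_ X0] [_ Y0]; exact: orlicz_premium_distribution.
Qed.
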